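(* Every pentagon in $\mathbb{CP}^2$ is $5$-self-dual. That is, for every pentagon with vertices $A_1,A_3,A_5,A_7,A_9$ (no three consecutive ones collinear) and sides $B_{2i}=A_{2i-1}A_{2i+1}$, indices modulo $10$, there is a projective isomorphism $g\colon P\to P^*$ with $g(A_i)=B_{i+5}^*$ for all odd $i$ modulo $10$.
   Context: $V=\mathbb C^3$, $P=\mathbb{CP}^2$ is its projectivization, $P^*$ is the projectivization of $V^*$. For a line $B$ of $P$ (a 2-dimensional subspace of $V$), $B^*\in P^*$ denotes its annihilator in $V^*$. Polygons are assumed non-degenerate: no three cyclically consecutive vertices are collinear. *)

(* Defs.v *)
(* MathComp world *)
From HB Require Import structures.
From mathcomp Require Import all_boot all_order all_algebra.
From mathcomp Require Import complex reals.

Set Implicit Arguments.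
Unset Strict Implicit.
Unset Printing Implicit Defensive.

Import GRing.Theory.
Local Open Scope ring_scope.

Section ProjectiveSpace.
Variable K : fieldType.

(* Points of the projectivization of [V]. *)
Definition projpoint (V : vectType K) : Type :=
  {U : {vspace V} | \dim U == 1%N}.

Definition projective_iso (V W : vectType K)
    (g : projpoint V -> projpoint W) : Prop :=
  exists phi : 'Hom(V, W),
    [/\ lker phi = 0%VS, limg phi = fullv
      & forall A : projpoint V, val (g A) = (phi @: val A)%VS].

Definition collinear (V : vectType K) (A B C : projpoint V) : Prop :=
  exists L : {vspace V},
    [/\ \dim L = 2%N, (val A <= L)%VS, (val B <= L)%VS & (val C <= L)%VS].

Definition dualspace (V : vectType K) : vectType K := 'Hom(V, K^o).

(* The functionals [f] whose restriction to [U], that is, [f] composed with a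
   projection onto [U], is zero; see [memv_annihilator]. *)
Definition annihilator (V : vectType K) (U : {vspace V}) :
    {vspace dualspace V} :=
  lker (linfun (fun f : 'Hom(V, K^o) => (f \o projv U)%VF)).

Lemma memv_annihilator (V : vectType K) (U : {vspace V}) (f : 'Hom(V, K^o)) :
  f \in annihilator U <-> (forall v, v \in U -> f v = 0).
Proof.
have lin : linear (fun f : 'Hom(V, K^o) => (f \o projv U)%VF).
  by move=> a g h; rewrite comp_lfunDl comp_lfunZl.
pose L := GRing.isLinear.Build K 'Hom(V, K^o) 'Hom(V, K^o) *:%R
  (fun f : 'Hom(V, K^o) => (f \o projv U)%VF) lin.
pose F : {linear 'Hom(V, K^o) -> 'Hom(V, K^o)} := HB.pack
  (fun f : 'Hom(V, K^o) => (f \o projv U)%VF) L.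
rewrite memv_ker -[X in linfun X]/(F : _ -> _) lfunE /=; split.
  by move/eqP/lfunP=> f0 v vU; have := f0 v; rewrite !lfunE /= projv_id.
move=> f0; apply/eqP/lfunP=> v; rewrite !lfunE /=.
by apply: f0; exact: memv_proj.
Qed.

(* The vertices and the sides of an [n]-gon are labelled by the odd and the
   even residues modulo [2n] respectively; only the values of [A] at odd
   residues are meaningful, and none of the predicates below looks at the
   others. As ['Z_0] is ['Z_2], [n] has to be positive. *)
Definition polygon (V : vectType K) (n : nat) : Type :=
  'Z_(n.*2) -> projpoint V.

Definition nondegenerate_polygon (V : vectType K) (n : nat) (A : polygon V n) :
    Prop :=
  forall i : 'Z_(n.*2), odd i -> ~ collinear (A i) (A (i + 2)) (A (i + 4)).

(* The line spanned by [A (j - 1)] and [A (j + 1)]. *)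
Definition side (V : vectType K) (n : nat) (A : polygon V n) (j : 'Z_(n.*2)) :
    {vspace V} :=
  (val (A (j - 1)%R) + val (A (j + 1)%R))%VS.

(* For odd [m], so that [i + m] labels a side whenever [i] labels a vertex. *)
Definition self_dual (m : nat) (V : vectType K) (n : nat) (A : polygon V n) :
    Prop :=
  exists g : projpoint V -> projpoint (dualspace V),
    projective_iso g /\
    forall i : 'Z_(n.*2), odd i ->
      val (g (A i)) = annihilator (side A (i + m%:R)).

End ProjectiveSpace.

(* Main.v *)
(* For five points no three consecutive of which are collinear, there is a
   nondegenerate symmetric bilinear form for which [a_k] and [a_(k+2)] are
   orthogonal for all [k] modulo 5 (five linear conditions on a six-dimensional
   space). By symmetry [a_k] is then orthogonal to both [a_(k+2)] and [a_(k+3)],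
   so the polarity of this form sends each vertex to the opposite side. *)
Require Import Defs.
From HB Require Import structures.
From mathcomp Require Import all_boot all_order all_algebra.
From mathcomp Require Import complex reals.
From mathcomp Require Import ring.

Set Implicit Arguments.
Unset Strict Implicit.
Unset Printing Implicit Defensive.

Import GRing.Theory.
Local Open Scope ring_scope.

(** * Determinants and sums in dimension three *)

Local Notation i0 := (@Ordinal 3 0 isT).
Local Notation i1 := (@Ordinal 3 1 isT).
Local Notation i2 := (@Ordinal 3 2 isT).

Lemma sum_ord3 (V : nmodType) (F : 'I_3 -> V) :
  \sum_i F i = F i0 + (F i1 + F i2).
Proof.
rewrite !big_ord_recl big_ord0 addr0.
by congr (F _ + (F _ + F _)); apply: val_inj.
Qed.

Lemma forall_ord3 (P : 'I_3 -> Prop) : P i0 -> P i1 -> P i2 -> forall i, P i.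
Proof.
by move=> P0 P1 P2 [[|[|[|//]]] lt_i3]; rewrite (bool_irrelevance lt_i3 isT).
Qed.

Lemma det_mx33 (R : comNzRingType) (M : 'M[R]_3) :
  \det M = M i0 i0 * (M i1 i1 * M i2 i2 - M i1 i2 * M i2 i1)
         - M i0 i1 * (M i1 i0 * M i2 i2 - M i1 i2 * M i2 i0)
         + M i0 i2 * (M i1 i0 * M i2 i1 - M i1 i1 * M i2 i0).
Proof.
rewrite (expand_det_row _ i0) sum_ord3 /cofactor.
rewrite !(expand_det_row _ ord0) !big_ord_recl !big_ord0 /cofactor !det_mx11 !mxE.
(* The nested expansions leave entries at differently built ordinals; indexing by natural numbers
   lets [ring] see which ones coincide. *)
pose m a b := M (inord a) (inord b).
have mE a b : M a b = m a b by rewrite /m !inord_val.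
by rewrite !mE /= /bump /=; ring.
Qed.

Lemma projpoint_line (K : fieldType) (V : vectType K) (P : projpoint V) :
  val P = <[vpick (val P)]>%VS.
Proof.
have /eqP dP := valP P; apply/esym/eqP.
by rewrite eqEdim -memvE memv_pick dP dim_vline vpick0 -dimv_eq0 dP.
Qed.

Section Rows.
Variable K : fieldType.
Implicit Types (u v w : 'rV[K]_3).

Definition rows3 u v w : 'M[K]_3 := \matrix_i [:: u; v; w]`_i.

Lemma mul_rows3 u v w (N : 'M[K]_3) :
  rows3 u v w *m N = rows3 (u *m N) (v *m N) (w *m N).
Proof.
by apply/row_matrixP; apply: forall_ord3; rewrite row_mul !rowK.
Qed.

Lemma det_rows3 u v w :
  \det (rows3 u v w) =
      u 0 i0 * (v 0 i1 * w 0 i2 - v 0 i2 * w 0 i1)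
    - u 0 i1 * (v 0 i0 * w 0 i2 - v 0 i2 * w 0 i0)
    + u 0 i2 * (v 0 i0 * w 0 i1 - v 0 i1 * w 0 i0).
Proof. by rewrite det_mx33 !mxE. Qed.

Lemma bilinE (G : 'M[K]_3) u w :
  (u *m G *m w^T) 0 0 = \sum_j (\sum_i u 0 i * G i j) * w 0 j.
Proof. by rewrite mxE; apply: eq_bigr => j _; rewrite !mxE. Qed.

Lemma bilinC (G : 'M[K]_3) u w :
  G^T = G -> (u *m G *m w^T) 0 0 = (w *m G *m u^T) 0 0.
Proof.
move=> symG; rewrite -[in LHS](trmxK (u *m G *m w^T)) mxE.
by rewrite !trmx_mul trmxK symG mulmxA.
Qed.

(* In the frame [a0, a1, a2], with [p = a3] and [q = a4], the conditions on
   [(a1, a3)] and [(a1, a4)] say that the middle row [(x, y, z)] of [G] is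
   orthogonal to [p] and [q], hence may be taken to be their cross product; the
   others then determine the remaining entries. The determinant of [G] is
   [(x z)^2 / (p0 q2)], where [p0], [q2], [x], [z] are, up to sign, the
   determinants of the four other triples of consecutive vertices. *)
Lemma pentagram_form_frame (p q : 'rV[K]_3)
    (e0 := delta_mx 0 i0 : 'rV[K]_3)
    (e1 := delta_mx 0 i1 : 'rV[K]_3)
    (e2 := delta_mx 0 i2 : 'rV[K]_3) :
  \det (rows3 e1 e2 p) != 0 -> \det (rows3 e2 p q) != 0 ->
  \det (rows3 p q e0) != 0 -> \det (rows3 q e0 e1) != 0 ->
  exists G : 'M[K]_3, [/\ G^T = G, G \in unitmx,
    (e0 *m G *m e2^T) 0 0 = 0, (e1 *m G *m p^T) 0 0 = 0 &
    [/\ (e2 *m G *m q^T) 0 0 = 0, (p *m G *m e0^T) 0 0 = 0 &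
        (q *m G *m e1^T) 0 0 = 0]].
Proof.
rewrite !det_rows3 !mxE /=.
rewrite !(mul0r, mul1r, mulr0, mulr1, mulrN, oppr0, opprK, addr0, add0r).
set p0 := p 0 i0; set p1 := p 0 i1; set p2 := p 0 i2.
set q0 := q 0 i0; set q1 := q 0 i1; set q2 := q 0 i2.
move=> p0N0 zN0 xN0 q2N0.
pose x := p1 * q2 - p2 * q1; pose y := p2 * q0 - p0 * q2.
pose z := p0 * q1 - p1 * q0.
pose r0 : 'rV[K]_3 := \row_j [:: - (x * p1 / p0); x; 0]`_j.
pose r1 : 'rV[K]_3 := \row_j [:: x; y; z]`_j.
pose r2 : 'rV[K]_3 := \row_j [:: 0; z; - (z * q1 / q2)]`_j.
exists (rows3 r0 r1 r2); split; last split.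
- by apply/matrixP; do 2!apply: forall_ord3; rewrite !mxE.
- rewrite unitmxE unitfE det_rows3 !mxE /=.
  suff -> : - (x * p1 / p0) * (y * (- (z * q1 / q2)) - z * z)
    - x * (x * (- (z * q1 / q2)) - z * 0) + 0 * (x * z - y * 0)
    = (x * z) ^+ 2 / (p0 * q2).
    by rewrite !(mulf_neq0, invr_eq0, expf_neq0).
  by rewrite /x /y /z; field; apply/andP.
all: rewrite bilinE !sum_ord3 !mxE /=
  -/p0 -/p1 -/p2 -/q0 -/q1 -/q2 /x /y /z;
  by [ring | field; rewrite ?p0N0 ?q2N0].
Qed.

(** Multiplying by the inverse of the matrix with rows [a0], [a1], [a2] turns these into the
    standard basis and scales all determinants by a nonzero factor. The form [G] found in that frame
    is then pulled back to [N *m G *m N^T]. *)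
Lemma pentagram_form (a0 a1 a2 a3 a4 : 'rV[K]_3) :
  \det (rows3 a0 a1 a2) != 0 -> \det (rows3 a1 a2 a3) != 0 ->
  \det (rows3 a2 a3 a4) != 0 -> \det (rows3 a3 a4 a0) != 0 ->
  \det (rows3 a4 a0 a1) != 0 ->
  exists G : 'M[K]_3, [/\ G^T = G, G \in unitmx,
    (a0 *m G *m a2^T) 0 0 = 0, (a1 *m G *m a3^T) 0 0 = 0 &
    [/\ (a2 *m G *m a4^T) 0 0 = 0, (a3 *m G *m a0^T) 0 0 = 0 &
        (a4 *m G *m a1^T) 0 0 = 0]].
Proof.
move=> d0 d1 d2 d3 d4; set M := rows3 a0 a1 a2 in d0.
have uM : M \in unitmx by rewrite unitmxE unitfE.
pose N := invmx M.
have uN : N \in unitmx by rewrite unitmx_inv.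
have dN u v w : \det (rows3 u v w) != 0 ->
    \det (rows3 (u *m N) (v *m N) (w *m N)) != 0.
  by move=> d; rewrite -mul_rows3 det_mulmx mulf_neq0 // -unitfE -unitmxE.
have rN i : row i M *m N = delta_mx 0 i by rewrite -row_mul mulmxV // row1.
move: (dN _ _ _ d1) (dN _ _ _ d2) (dN _ _ _ d3) (dN _ _ _ d4).
have := rN i0; rewrite rowK /= => e0; have := rN i1; rewrite rowK /= => e1.
have := rN i2; rewrite rowK /= => e2.
rewrite e0 e1 e2 => f1 f2 f3 f4.
have [G [symG uG c0 c1 [c2 c3 c4]]] := pentagram_form_frame f1 f2 f3 f4.
have bE u w : u *m (N *m G *m N^T) *m w^T = (u *m N) *m G *m (w *m N)^T.
  by rewrite trmx_mul !mulmxA.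
exists (N *m G *m N^T); rewrite !bE e0 e1 e2; split => //.
  by rewrite !trmx_mul trmxK symG mulmxA.
by rewrite !unitmx_mul uN uG unitmx_tr uN.
Qed.

(** * Collinearity, bases and determinants *)

Lemma det_rows3_ncollinear (A B C : projpoint 'rV[K]_3) :
  ~ collinear A B C ->
  \det (rows3 (vpick (val A)) (vpick (val B)) (vpick (val C))) != 0.
Proof.
(* If the determinant vanished, some nonzero [c] would be orthogonal to all three rows, and the
   kernel of [u |-> u *m c^T] would be a line through the three points. The transpose is taken
   because [det0P] gives vectors of the left kernel. *)
move=> ncol; apply/negP => /eqP; rewrite -det_tr => d0; apply: ncol.
have [c cN0 Mc] : exists2 c : 'rV[K]_3, c != 0 &
    c *m (rows3 (vpick (val A)) (vpick (val B)) (vpick (val C)))^T = 0.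
  by apply/det0P/eqP.
pose F0 (u : 'rV[K]_3) : K^o := (u *m c^T) 0 0.
have lin : linear F0.
  by move=> t u v; rewrite /F0 mulmxDl -scalemxAl !mxE.
pose L := GRing.isLinear.Build K 'rV[K]_3 K^o *:%R F0 lin.
pose F : {linear 'rV[K]_3 -> K^o} := HB.pack F0 L.
have kF u : (u \in lker (linfun F)) = (u *m c^T == 0).
  rewrite memv_ker lfunE /=; apply/eqP/eqP => [h|h]; last by rewrite /F0 h mxE.
  by rewrite [LHS]mx11_scalar -/(F0 u) h raddf0.
have pt (P : projpoint 'rV[K]_3) :
    vpick (val P) *m c^T == 0 -> (val P <= lker (linfun F))%VS.
  by move=> h; rewrite projpoint_line -memvE kF.
have cT i : row i (rows3 (vpick (val A)) (vpick (val B)) (vpick (val C))) *m c^T = 0.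
  by rewrite -row_mul -[X in row _ (X *m _)]trmxK -trmx_mul Mc trmx0 row0.
exists (lker (linfun F)); split; last 3 first.
- by apply: pt; have := cT i0; rewrite rowK => ->.
- by apply: pt; have := cT i1; rewrite rowK => ->.
- by apply: pt; have := cT i2; rewrite rowK => ->.
(* By rank-nullity the kernel has dimension 2 once the rank is 1; it is at most 1 since the target
   is [K^o], and rank 0 would force [c = 0]. *)
have := limg_ker_dim (linfun F) fullv; rewrite capfv dimvf /dim /= mul1n.
suff -> : \dim (limg (linfun F)) = 1%N by rewrite addn1 => -[].
apply/eqP; rewrite eqn_leq; apply/andP; split.
  by apply: leq_trans (dimvS (subvf _)) _; rewrite dimvf.
rewrite lt0n dimv_eq0; apply: contraNneq cN0 => F_eq0.
have Fu u : u *m c^T = 0.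
  apply/eqP; rewrite -kF memv_ker.
  by rewrite -memv0 -F_eq0 memv_img ?memvf.
rewrite -trmx_eq0; apply/eqP/row_matrixP => i.
by rewrite rowE Fu row0.
Qed.

Lemma lfun_eq0_rows3 u v w (f : 'Hom('rV[K]_3, K^o)) :
  \det (rows3 u v w) != 0 -> f u = 0 -> f v = 0 -> f w = 0 -> f = 0.
Proof.
move=> d fu fv fw; apply/lfunP => t; rewrite lfunE /=.
have uM : rows3 u v w \in unitmx by rewrite unitmxE unitfE.
rewrite -[t](mulmxKV uM) mulmx_sum_row sum_ord3 !rowK /=.
by rewrite !linearD !linearZ /= fu fv fw !scaler0 !addr0.
Qed.

(** * The polarity of a bilinear form *)

Definition bilin_fun (G : 'M[K]_3) u w : K^o := (u *m G *m w^T) 0 0.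

Lemma bilin_fun_linear G u : linear (bilin_fun G u).
Proof.
by move=> t v w; rewrite /bilin_fun linearP /= mulmxDr -scalemxAr !mxE.
Qed.

HB.instance Definition _ G u :=
  GRing.isLinear.Build K 'rV[K]_3 K^o *:%R (bilin_fun G u) (bilin_fun_linear G u).

Definition polarity_fun (G : 'M[K]_3) u : 'Hom('rV[K]_3, K^o) :=
  linfun (bilin_fun G u).

Lemma polarity_fun_linear G : linear (polarity_fun G).
Proof.
move=> t u v; apply/lfunP => w; rewrite !lfunE /= !lfunE /= !lfunE /=.
by rewrite /bilin_fun !mulmxDl -!scalemxAl !mxE.
Qed.

HB.instance Definition _ G :=
  GRing.isLinear.Build K 'rV[K]_3 'Hom('rV[K]_3, K^o) *:%R (polarity_fun G)
    (polarity_fun_linear G).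

(** The correlation of the form with matrix [G]; the ascription gives it the codomain [dualspace]
    that [self_dual] asks for. *)
Definition polarity (G : 'M[K]_3) : 'Hom('rV[K]_3, dualspace 'rV[K]_3) :=
  linfun (polarity_fun G : 'rV[K]_3 -> dualspace 'rV[K]_3).

Lemma polarityE G u w :
  (polarity G u : 'Hom('rV[K]_3, K^o)) w = (u *m G *m w^T) 0 0.
Proof. by rewrite /polarity (lfunE (polarity_fun G)) /= lfunE. Qed.

(** Pairing with the standard basis vectors recovers the coordinates of [u *m G], which therefore
    vanishes for [u] in the kernel. *)
Lemma lker_polarity G : G \in unitmx -> lker (polarity G) = 0%VS.
Proof.
move=> uG; apply/eqP; rewrite -subv0; apply/subvP => u.
rewrite memv_ker memv0 => /eqP u0.
suff: u *m G = 0 by move=> h; rewrite -[u](mulmxK uG) h mul0mx.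
apply/rowP => j; rewrite [RHS]mxE.
have := polarityE G u (delta_mx 0 j); rewrite u0 lfunE /= trmx_delta.
by rewrite -colE mxE => <-.
Qed.

Lemma limg_polarity G : G \in unitmx -> limg (polarity G) = fullv.
Proof.
move=> uG; apply/eqP; rewrite eqEdim subvf /=.
by rewrite limg_dim_eq ?lker_polarity ?capv0 // !dimvf.
Qed.

End Rows.

(** * Self-duality of the pentagon *)

Theorem pentagon_self_dual (K : fieldType) (A : polygon 'rV[K]_3 5) :
  nondegenerate_polygon A -> self_dual 5 A.
Proof.
move=> hA; pose a i := vpick (val (A i)).
have d (i : 'Z_10) : odd i -> \det (rows3 (a i) (a (i + 2)) (a (i + 4))) != 0.
  by move=> oi; apply: det_rows3_ncollinear; apply: hA.
have odd_ind (P : 'Z_10 -> Prop) :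
    P 1 -> P 3 -> P 5 -> P 7 -> P 9 -> forall i : 'Z_10, odd i -> P i.
  move=> P1 P3 P5 P7 P9 i oi.
  have: i \in [:: 1; 3; 5; 7; 9 : 'Z_10].
    by case: i oi => -[|[|[|[|[|[|[|[|[|[|//]]]]]]]]]].
  by rewrite !inE => /or4P[|||/orP[]] /eqP->.
(* Labels such as [7 + 4] and [1] agree only after reduction modulo 10, so they are compared by
   value. *)
have z10 (i j : 'Z_10) : val i = val j -> a i = a j by move/val_inj->.
(* The vector [a_k] of [pentagram_form] is the vertex labelled [2k + 1], so a shift of [k] by 2 is a
   shift of labels by 4. *)
have [G [symG uG c1 c3 [c5 c7 c9]]] :
    exists G : 'M[K]_3, [/\ G^T = G, G \in unitmx,
    (a 1 *m G *m (a 5)^T) 0 0 = 0, (a 3 *m G *m (a 7)^T) 0 0 = 0 &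
    [/\ (a 5 *m G *m (a 9)^T) 0 0 = 0, (a 7 *m G *m (a 1)^T) 0 0 = 0 &
        (a 9 *m G *m (a 3)^T) 0 0 = 0]].
  apply: pentagram_form.
  - by have := d 1 isT; rewrite (z10 (1 + 2) 3) // (z10 (1 + 4) 5).
  - by have := d 3 isT; rewrite (z10 (3 + 2) 5) // (z10 (3 + 4) 7).
  - by have := d 5 isT; rewrite (z10 (5 + 2) 7) // (z10 (5 + 4) 9).
  - by have := d 7 isT; rewrite (z10 (7 + 2) 9) // (z10 (7 + 4) 1).
  - by have := d 9 isT; rewrite (z10 (9 + 2) 1) // (z10 (9 + 4) 3).
have perp (i : 'Z_10) : odd i -> (a i *m G *m (a (i + 4))^T) 0 0 = 0.
  apply: (odd_ind (fun i : 'Z_10 => (a i *m G *m (a (i + 4))^T) 0 0 = 0)).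
  - by rewrite (z10 (1 + 4) 5).
  - by rewrite (z10 (3 + 4) 7).
  - by rewrite (z10 (5 + 4) 9).
  - by rewrite (z10 (7 + 4) 1).
  - by rewrite (z10 (9 + 4) 3).
have odd2 (i : 'Z_10) : odd i -> odd (i + 2)%R.
  by apply: (odd_ind (fun i : 'Z_10 => odd (i + 2)%R)).
have perp' (i : 'Z_10) : odd i -> (a i *m G *m (a (i + 6))^T) 0 0 = 0.
  move=> oi; rewrite bilinC //.
  have := perp (i + 6); rewrite -addrA (_ : 6 + 4 = 0) ?addr0; last exact: val_inj.
  by apply; have := odd2 _ (odd2 _ (odd2 _ oi)); rewrite -!addrA.
have dimP (P : projpoint 'rV[K]_3) : \dim (polarity G @: val P) == 1%N.
  by rewrite limg_dim_eq ?lker_polarity ?capv0 //; exact: valP P.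
exists (fun P => Sub (polarity G @: val P)%VS (dimP P)); split.
  by exists (polarity G); split; [exact: lker_polarity | exact: limg_polarity | ].
move=> i oi /=; rewrite projpoint_line -/(a i) limg_line.
(* The ends of the side opposite to vertex [i] are exactly the two vertices that [perp] and [perp']
   make orthogonal to [a i]. *)
have sideE : side A (i + 5%:R) = (<[a (i + 4)%R]> + <[a (i + 6)%R]>)%VS.
  rewrite /side -!projpoint_line; congr (val (A _) + val (A _))%VS.
    by rewrite -addrA; congr (_ + _); apply: val_inj.
  by rewrite -addrA; congr (_ + _); apply: val_inj.
have aN0 : polarity G (a i) != 0.
  rewrite -memv_ker lker_polarity // memv0 /a vpick0 -dimv_eq0.
  by have /eqP-> := valP (A i).
have d' : \det (rows3 (a (i + 2)) (a (i + 4)) (a (i + 6))) != 0.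
  have e4 : a (i + 2 + 2) = a (i + 4).
    by rewrite -addrA; congr (a (_ + _)); apply: val_inj.
  have e6 : a (i + 2 + 4) = a (i + 6).
    by rewrite -addrA; congr (a (_ + _)); apply: val_inj.
  by have := d _ (odd2 _ oi); rewrite e4 e6.
apply/eqP; rewrite eqEsubv; apply/andP; split.
  rewrite -memvE; apply/memv_annihilator => v; rewrite sideE.
  case/memv_addP => _ /vlineP[s ->] [_ /vlineP[t ->] ->].
  by rewrite linearD !linearZ /= !polarityE perp // perp' // !scaler0 addr0.
(* Conversely, [f] and the image [h] of [a i] both vanish at the vertices [i + 4] and [i + 6], which
   form a basis together with vertex [i + 2]. Hence [f] is the multiple of [h] given by the ratio of
   their values at [i + 2]. *)
apply/subvP => f /memv_annihilator; rewrite sideE => f0.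
have f4 : f (a (i + 4)) = 0.
  by apply: f0; apply: subvP (addvSl _ _) _ (memv_line _).
have f6 : f (a (i + 6)) = 0.
  by apply: f0; apply: subvP (addvSr _ _) _ (memv_line _).
set h : 'Hom('rV[K]_3, K^o) := polarity G (a i) in aN0 *.
have h4 : h (a (i + 4)) = 0 by rewrite polarityE perp.
have h6 : h (a (i + 6)) = 0 by rewrite polarityE perp'.
(* Otherwise [h] would vanish on the whole basis, contradicting [aN0]. *)
have h2 : h (a (i + 2)) != 0.
  by apply: contraNneq aN0 => h2; apply/eqP; apply: (lfun_eq0_rows3 d').
apply/vlineP; exists (f (a (i + 2)) / h (a (i + 2))).
apply/eqP; rewrite -subr_eq0; apply/eqP; apply: (lfun_eq0_rows3 d').
- by rewrite add_lfunE opp_lfunE scale_lfunE [_ *: _]divfK ?subrr.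
- by rewrite add_lfunE opp_lfunE scale_lfunE f4 h4 scaler0 subrr.
- by rewrite add_lfunE opp_lfunE scale_lfunE f6 h6 scaler0 subrr.
Qed.

Theorem proposition5 (R : realType) (A : polygon 'rV[R[i]]_3 5)
    (hA : nondegenerate_polygon A) : self_dual 5 A.
Proof. exact: pentagon_self_dual. Qed.
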